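(* Let $\mu$ be a cardinal with $\mu>\mathrm{cf}(\mu)=\kappa>\aleph_0$ and $\lambda=\mu^+$. (1) $\clubsuit^\ast_{-\mu}(\lambda\setminus S^\lambda_\kappa)$ holds, and $\clubsuit^\ast_{-\mu}(S^\lambda_\kappa)/{\cal I}[\lambda,\kappa)$ holds. (2) If moreover $\mu$ is a strong limit cardinal, then $\clubsuit^\ast(\lambda\setminus S^\lambda_\kappa)$ holds and $\clubsuit^\ast(S^\lambda_\kappa)/{\cal I}[\lambda,\kappa)$ holds.
   Context: $LIM$ is the class of limit ordinals; $S^\lambda_\kappa=\{\delta<\lambda:\mathrm{cf}(\delta)=\kappa\}$. ${\cal I}[\lambda,\kappa)$ is the family of all $A\subseteq\lambda$ for which there is $h:\lambda\to\kappa$ such that for every $\delta\in A\cap S^\lambda_\kappa$ there is a club $C$ of $\delta$ with $h\restriction C$ strictly increasing. For a stationary $S\subseteq\lambda$: $\clubsuit^\ast_{-\mu}(S)$ means there is a sequence $\langle{\cal P}_\alpha:\alpha\in S\cap LIM\rangle$ such that each ${\cal P}_\alpha$ is a family of at most $|\alpha|$ unbounded subsets of $\alpha$, each of order type $<\mu$, and for every $A\in[\lambda]^\lambda$ there is a club $C_A$ of $\lambda$ with $C_A\cap S\cap LIM\subseteq G[A]:=\{\alpha:\exists B\in{\cal P}_\alpha\,(\alpha=\sup(B\cap A))\}$. $\clubsuit^\ast(S)$ means there is a sequence $\langle{\cal P}_\alpha:\alpha\in S\cap LIM\rangle$ such that $|{\cal P}_\alpha|\le|\alpha|$, every $B\in{\cal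 P}_\alpha$ is an unbounded subset of $\alpha$, and for every $A\in[\lambda]^\lambda$ there is a club $C_A$ of $\lambda$ with $C_A\cap S\cap LIM\subseteq G[A]:=\{\alpha:\exists B\in{\cal P}_\alpha\,(B\subseteq A)\}$. For an ideal ${\cal I}$ on $\lambda$, the versions $\clubsuit^\ast_{-\mu}(S)/{\cal I}$ and $\clubsuit^\ast(S)/{\cal I}$ are the same except that for each $A\in[\lambda]^\lambda$ it is only required that there be a club $C_A$ of $\lambda$ with $(C_A\cap S\cap LIM)\setminus G[A]\in{\cal I}$. *)

(* Defs.v *)
(* Combinatorial set theory on well-ordered types.
   Ordinals/cardinals are represented (up to isomorphism) by well-ordered
   types; all notions below are invariant under order isomorphism. *)

Record WO := {
  car :> Type;
  ord : car -> car -> Prop;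
  ord_wf : well_founded ord;
  ord_trans : forall x y z, ord x y -> ord y z -> ord x z;
  ord_total : forall x y, ord x y \/ x = y \/ ord y x
}.
Arguments ord {w} _ _.

Definition le {X : WO} (x y : X) : Prop := ord x y \/ x = y.

Definition card_le (A B : Type) : Prop :=
  exists f : A -> B, forall x y, f x = f y -> x = y.
Definition card_lt (A B : Type) : Prop := card_le A B /\ ~ card_le B A.

Definition seg {X : WO} (x : X) : Type := {y : X | ord y x}.

Definition initial (X : WO) : Prop := forall x : X, ~ card_le X (seg x).

Definition uncountable (K : Type) : Prop := ~ card_le K nat.

Definition incr_on {X Y : WO} (P : X -> Prop) (f : X -> Y) : Prop :=
  forall x y, P x -> P y -> ord x y -> ord (f x) (f y).

Definition unbounded {X : WO} (B : X -> Prop) : Prop :=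
  forall y, exists z, B z /\ le y z.

Definition unbounded_below {X : WO} (d : X) (B : X -> Prop) : Prop :=
  forall y, ord y d -> exists z, B z /\ ord z d /\ le y z.

Definition is_limit {X : WO} (d : X) : Prop :=
  (exists y, ord y d) /\ forall y, ord y d -> exists z, ord y z /\ ord z d.

Definition cf_top_is (X K : WO) : Prop :=
  initial K /\
  (exists f : K -> X, incr_on (fun _ => True) f /\
                      unbounded (fun x => exists k, f k = x)) /\
  (forall B : X -> Prop, unbounded B -> card_le K {x : X | B x}).

Definition cf_is {X : WO} (d : X) (K : WO) : Prop :=
  initial K /\
  (exists f : K -> X, incr_on (fun _ => True) f /\ (forall k, ord (f k) d) /\
                      unbounded_below d (fun x => exists k, f k = x)) /\
  (forall B : X -> Prop, (forall x, B x -> ord x d) -> unbounded_below d B ->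
                         card_le K {x : X | B x}).

Definition is_succ_card (M L : WO) : Prop :=
  initial L /\ card_lt M L /\ forall l : L, card_le (seg l) M.

Definition strong_limit (M : WO) : Prop :=
  forall m : M, card_lt (seg m -> Prop) M.

Definition S_cof {L : WO} (K : WO) (d : L) : Prop := cf_is d K.

Definition club {L : WO} (C : L -> Prop) : Prop :=
  unbounded C /\ forall d, is_limit d -> unbounded_below d C -> C d.

Definition club_below {L : WO} (d : L) (C : L -> Prop) : Prop :=
  (forall x, C x -> ord x d) /\ unbounded_below d C /\
  forall g, ord g d -> is_limit g -> unbounded_below g C -> C g.

Definition in_I (L K : WO) (A : L -> Prop) : Prop :=
  exists h : L -> K, forall d, A d -> S_cof K d ->
    exists C, club_below d C /\ incr_on C h.

Definition otp_lt {L : WO} (B : L -> Prop) (M : WO) : Prop :=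
  exists (m : M) (f : L -> M), incr_on B f /\ forall x, B x -> ord (f x) m.

Definition big {L : WO} (A : L -> Prop) : Prop := card_le L {x : L | A x}.

Definition family_minus (M L : WO) (S : L -> Prop)
    (P : L -> (L -> Prop) -> Prop) : Prop :=
  forall a, S a -> is_limit a ->
    card_le {B : L -> Prop | P a B} (seg a) /\
    forall B, P a B -> (forall x, B x -> ord x a) /\ unbounded_below a B /\
                       otp_lt B M.

Definition family_plain (L : WO) (S : L -> Prop)
    (P : L -> (L -> Prop) -> Prop) : Prop :=
  forall a, S a -> is_limit a ->
    card_le {B : L -> Prop | P a B} (seg a) /\
    forall B, P a B -> (forall x, B x -> ord x a) /\ unbounded_below a B.

Definition G_minus {L : WO} (P : L -> (L -> Prop) -> Prop) (A : L -> Prop)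
    (a : L) : Prop :=
  exists B, P a B /\ unbounded_below a (fun x => B x /\ A x).

Definition G_plain {L : WO} (P : L -> (L -> Prop) -> Prop) (A : L -> Prop)
    (a : L) : Prop :=
  exists B, P a B /\ forall x, B x -> A x.

Definition clubsuit_minus (M L : WO) (S : L -> Prop) : Prop :=
  exists P, family_minus M L S P /\
    forall A, big A -> exists C, club C /\
      forall a, C a -> S a -> is_limit a -> G_minus P A a.

Definition clubsuit_minus_mod (M L : WO) (S : L -> Prop)
    (I : (L -> Prop) -> Prop) : Prop :=
  exists P, family_minus M L S P /\
    forall A, big A -> exists C, club C /\
      I (fun a => C a /\ S a /\ is_limit a /\ ~ G_minus P A a).

Definition clubsuit_star (L : WO) (S : L -> Prop) : Prop :=
  exists P, family_plain L S P /\
    forall A, big A -> exists C, club C /\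
      forall a, C a -> S a -> is_limit a -> G_plain P A a.

Definition clubsuit_star_mod (L : WO) (S : L -> Prop)
    (I : (L -> Prop) -> Prop) : Prop :=
  exists P, family_plain L S P /\
    forall A, big A -> exists C, club C /\
      I (fun a => C a /\ S a /\ is_limit a /\ ~ G_plain P A a).

(* Main.v *)
(** Let [g : K -> M] be increasing and cofinal and fix injections [seg d -> M].
    The preimage [b d i] of [seg (g i)] is then a piece of [d] of size [< M],
    and the pieces increase with union [d].  If [A] is unbounded in [d] but
    bounded on each piece, the bounds form a monotone cofinal [K]-sequence, so
    [cf d = K]; hence the pieces guess [A] at every limit of [A] of another
    cofinality.

    If [cf d = K], take a continuous cofinal [c : K -> d] and use the sets
    [a d i], the union over [xi] of [b (c xi) i], which still have size [< M] by
    Hessenberg's theorem.  Given [A], let [h x] be an index for which [A] is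
    unbounded on [b x (h x)].  If no [a d i] guesses [A] at [d], then [h (c xi)]
    tends to [K] along the limit points of [c], so [h] is strictly increasing on
    a club of [d] (this uses [K > aleph_0]), i.e. the bad set is in [I].

    For a strong limit [M], each guessing set has fewer than [M] subsets, and
    the family of all their unbounded subsets guesses in the stronger sense. *)
From Stdlib Require Import Classical ClassicalEpsilon FunctionalExtensionality
  PropExtensionality Wellfounded Relation_Operators Cantor Lia.
Require Import Defs.

(** * Well-orders: elementary facts, least elements, recursion *)

Lemma ord_irrefl (X : WO) (x : X) : ~ ord x x.
Proof.
  induction (ord_wf X x) as [x _ IH]. intro H. exact (IH x H H).
Qed.

Lemma lt_le_trans (X : WO) (x y z : X) : ord x y -> le y z -> ord x z.
Proof. intros H [H'| <-]; [eapply ord_trans|]; eauto. Qed.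

Lemma le_lt_trans (X : WO) (x y z : X) : le x y -> ord y z -> ord x z.
Proof. intros [H| ->] H'; [eapply ord_trans|]; eauto. Qed.

Lemma le_trans (X : WO) (x y z : X) : le x y -> le y z -> le x z.
Proof.
  intros H [H'| <-]; [left; eapply le_lt_trans|]; eauto.
Qed.

Lemma le_refl (X : WO) (x : X) : le x x.
Proof. now right. Qed.

Lemma not_lt (X : WO) (x y : X) : ~ ord x y -> le y x.
Proof. destruct (ord_total X x y) as [H|[H|H]]; firstorder. Qed.

Lemma not_le (X : WO) (x y : X) : ~ le x y -> ord y x.
Proof. destruct (ord_total X x y) as [H|[H|H]]; firstorder. Qed.

Lemma lt_not_le (X : WO) (x y : X) : ord x y -> ~ le y x.
Proof. intros H H'. exact (ord_irrefl X x (lt_le_trans X _ _ _ H H')). Qed.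

Lemma le_antisym (X : WO) (x y : X) : le x y -> le y x -> x = y.
Proof.
  intros [H|H] H'; [|exact H]. destruct (lt_not_le _ _ _ H H').
Qed.

Lemma exists_upper (X : WO) (x y : X) : exists z, le x z /\ le y z.
Proof.
  destruct (ord_total X x y) as [H|[H|H]].
  - exists y. split; [now left|apply le_refl].
  - exists y. split; [now right|apply le_refl].
  - exists x. split; [apply le_refl|now left].
Qed.

Lemma exists_least (X : WO) (P : X -> Prop) :
  (exists x, P x) -> exists x, P x /\ forall y, P y -> le x y.
Proof.
  intros [x Hx]. apply NNPP. intro N.
  assert (forall x, ~ P x) as N'; [|exact (N' x Hx)].
  clear x Hx. intro x. induction (ord_wf X x) as [x _ IH]. intro Hx.
  apply N. exists x. split; [assumption|].
  intros y Hy. apply not_lt. intro H. exact (IH y H Hy).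
Qed.

Lemma incr_reflect (X Y : WO) (f : X -> Y) :
  (forall x y, ord x y -> ord (f x) (f y)) ->
  forall x y, ord (f x) (f y) -> ord x y.
Proof.
  intros Hf x y H. apply not_le. intros [H'| ->].
  - exact (ord_irrefl _ _ (ord_trans _ _ _ _ H (Hf _ _ H'))).
  - exact (ord_irrefl _ _ H).
Qed.

Lemma incr_weak (X Y : WO) (f : X -> Y) :
  (forall x y, ord x y -> ord (f x) (f y)) ->
  forall x y, le x y -> le (f x) (f y).
Proof. intros Hf x y [H| ->]; [left; auto|apply le_refl]. Qed.

(* Transfinite recursion along [X] where the value at [x] is any solution of a
   constraint on the values below [x]. *)
Lemma wf_choice (X : WO) (Y : Type) (y0 : Y) (R : X -> (X -> Y) -> Y -> Prop)
  (Rext : forall x g g', (forall z, ord z x -> g z = g' z) ->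
          forall y, R x g y -> R x g' y) :
  exists G : X -> Y, forall x, (exists y, R x G y) -> R x G (G x).
Proof.
  (* The filler [y0] stands for values not yet defined; [Rext] makes it harmless. *)
  set (ext := fun (x : X) (rec : forall z, ord z x -> Y) (z : X) =>
    match excluded_middle_informative (ord z x) with
    | left H => rec z H
    | right _ => y0
    end).
  set (F := fun (x : X) (rec : forall z, ord z x -> Y) =>
    epsilon (inhabits y0) (R x (ext x rec))).
  set (G := Fix (ord_wf X) (fun _ => Y) F).
  assert (HG : forall x, G x = F x (fun z _ => G z)).
  { intro x. unfold G. apply (Fix_eq (ord_wf X) (fun _ => Y) F).
    intros x' f g Hfg.
    replace g with f; [reflexivity|].
    extensionality z. extensionality H. apply Hfg. }
  exists G. intros x Hx.
  assert (E : forall z, ord z x -> G z = ext x (fun z _ => G z) z).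
  { intros z Hz. unfold ext. now destruct excluded_middle_informative. }
  apply (Rext x (ext x (fun z _ => G z)) G).
  { intros z Hz. symmetry. auto. }
  rewrite HG. unfold F. apply epsilon_spec.
  destruct Hx as [y Hy]. exists y. exact (Rext _ _ _ E _ Hy).
Qed.

(** * Comparison of cardinalities *)

Lemma sig_eq (A : Type) (P : A -> Prop) (x y : {a | P a}) :
  proj1_sig x = proj1_sig y -> x = y.
Proof.
  destruct x as [x Hx], y as [y Hy]. simpl. intros <-.
  now rewrite (proof_irrelevance _ Hx Hy).
Qed.

Lemma pred_ext (A : Type) (P Q : A -> Prop) : (forall x, P x <-> Q x) -> P = Q.
Proof.
  intro H. extensionality x. now apply propositional_extensionality.
Qed.

Lemma choice_fun (A B : Type) (R : A -> B -> Prop) :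
  (forall a, exists b, R a b) -> exists f : A -> B, forall a, R a (f a).
Proof.
  intro H.
  exists (fun a => proj1_sig (constructive_indefinite_description _ (H a))).
  intro a. apply proj2_sig.
Qed.

Lemma card_le_rel (A B : Type) (R : A -> B -> Prop) :
  (forall a, exists b, R a b) ->
  (forall a a' b, R a b -> R a' b -> a = a') -> card_le A B.
Proof.
  intros H U. destruct (choice_fun _ _ _ H) as [f Hf].
  exists f. intros x y E. apply (U x y (f x)); [apply Hf|rewrite E; apply Hf].
Qed.

Lemma card_le_refl (A : Type) : card_le A A.
Proof. now exists (fun a => a). Qed.

Lemma card_le_trans (A B C : Type) : card_le A B -> card_le B C -> card_le A C.
Proof.
  intros [f Hf] [g Hg]. exists (fun a => g (f a)). auto.
Qed.

Lemma card_le_prod (A B C D : Type) :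
  card_le A B -> card_le C D -> card_le (A * C) (B * D).
Proof.
  intros [f Hf] [g Hg]. exists (fun p => (f (fst p), g (snd p))).
  intros [a c] [a' c'] E. injection E as E1 E2. f_equal; auto.
Qed.

Lemma card_le_sub (A : Type) (P Q : A -> Prop) :
  (forall x, P x -> Q x) -> card_le {x | P x} {x | Q x}.
Proof.
  intro H. exists (fun x => exist Q (proj1_sig x) (H _ (proj2_sig x))).
  intros x y E. apply sig_eq. exact (f_equal (@proj1_sig _ _) E).
Qed.

Lemma card_le_sig (A : Type) (P : A -> Prop) : card_le {x | P x} A.
Proof.
  exists (@proj1_sig _ _). intros x y. apply sig_eq.
Qed.

Lemma card_le_seg (X : WO) (x y : X) : le x y -> card_le (seg x) (seg y).
Proof.
  intro H. apply card_le_sub. intros z Hz. exact (lt_le_trans _ _ _ _ Hz H).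
Qed.

(** Hilbert's hotel along the copy [i] of [nat]: [None] goes to [i 0], [i n] moves to [i (S n)], and
    the rest stays. *)
Lemma card_le_option (A : Type) : card_le nat A -> card_le (option A) A.
Proof.
  intros [i Hi].
  apply card_le_rel with (R := fun o a =>
    (o = None /\ a = i 0) \/ (exists n, o = Some (i n) /\ a = i (S n)) \/
    (o = Some a /\ forall n, a <> i n)).
  - intros [a|].
    + destruct (classic (exists n, a = i n)) as [[n ->]|N].
      * exists (i (S n)). eauto.
      * exists a. right; right. split; [reflexivity|]. intros n E. eauto.
    + exists (i 0). auto.
  - intros o o' a [[-> Ea]|[[n [-> Ea]]|[-> N]]]
      [[-> Eb]|[[m [-> Eb]]|[-> N']]]; try reflexivity;
      try (exfalso; eapply N; eassumption);
      try (exfalso; eapply N'; eassumption); subst a; apply Hi in Eb;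
      congruence.
Qed.

Lemma card_le_option_mono (A B : Type) :
  card_le A B -> card_le (option A) (option B).
Proof.
  intros [f Hf]. exists (option_map f).
  intros [a|] [b|] E; simpl in E; try congruence. injection E as E. f_equal; auto.
Qed.

(** At most one index is sent to [None]; the sequence is started after it. *)
Lemma nat_le_of_option (A : Type) : card_le nat (option A) -> card_le nat A.
Proof.
  intros [j Hj].
  assert (H : exists n0, forall n, j (n0 + n) <> None).
  { destruct (classic (exists n, j n = None)) as [[n E]|N].
    - exists (S n). intros m E'. rewrite <- E in E'. apply Hj in E'. lia.
    - exists 0. eauto. }
  destruct H as [n0 H].
  apply card_le_rel with (R := fun n a => j (n0 + n) = Some a).
  - intro n. destruct (j (n0 + n)) as [a|] eqn:E; [eauto|now destruct (H n)].
  - intros n m a E E'. rewrite <- E' in E. apply Hj in E. lia.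
Qed.

Lemma card_le_nat_square : card_le (nat * nat) nat.
Proof.
  exists Cantor.to_nat. exact Cantor.to_nat_inj.
Qed.

(** * Initial segments and Hessenberg's theorem *)

Definition seg_wo (X : WO) (x : X) : WO.
Proof.
  refine {| car := seg x; ord := fun y z => ord (proj1_sig y) (proj1_sig z) |}.
  - apply wf_inverse_image, ord_wf.
  - intros y z t. apply ord_trans.
  - intros y z.
    destruct (ord_total X (proj1_sig y) (proj1_sig z)) as [H|[H|H]]; auto.
    right; left. now apply sig_eq.
Defined.

Lemma card_le_or_seg (X : WO) (Y : Type) :
  card_le X Y \/ exists x : X, card_le Y (seg x).
Proof.
  (* [None] serves as default because [Y] may be empty. *)
  destruct (wf_choice X (option Y) None (fun x g o =>
    exists y, o = Some y /\ forall z, ord z x -> g z <> Some y)) as [G HG].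
  { intros x g g' E o [y [-> H]]. exists y. split; [reflexivity|].
    intros z Hz. rewrite <- E by assumption. auto. }
  destruct (classic (exists x, forall y, exists z, ord z x /\ G z = Some y))
    as [[x Hx]|N].
  - right. exists x.
    apply card_le_rel with (R := fun y z => G (proj1_sig z) = Some y).
    + intro y. destruct (Hx y) as [z [Hz E]]. now exists (exist _ z Hz).
    + intros y y' z E E'. congruence.
  - left.
    assert (H : forall x, exists y, G x = Some y /\
      forall z, ord z x -> G z <> Some y).
    { intro x. apply HG. apply NNPP. intro N'. apply N. exists x. intro y.
      apply NNPP. intro N''. apply N'. exists (Some y), y.
      split; [reflexivity|]. intros z Hz E. eauto. }
    apply card_le_rel with (R := fun x y => G x = Some y).
    + intro x. destruct (H x) as [y [E _]]. eauto.
    + intros x x' y E E'.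
      destruct (ord_total X x x') as [O|[O|O]]; [|assumption|].
      * destruct (H x') as [y' [E1 N']]. destruct (N' x O). congruence.
      * destruct (H x) as [y' [E1 N']]. destruct (N' x' O). congruence.
Qed.

Lemma card_le_nat_or (X : WO) : card_le X nat \/ card_le nat X.
Proof.
  destruct (card_le_or_seg X nat) as [H|[x H]]; [now left|right].
  exact (card_le_trans _ _ _ H (card_le_sig _ _)).
Qed.

Lemma card_le_closed_seg (X : WO) (x : X) :
  card_le {y : X | le y x} (option (seg x)).
Proof.
  apply card_le_rel with (R := fun y o =>
    match o with Some z => proj1_sig y = proj1_sig z | None => proj1_sig y = x end).
  - intros [y [H|H]].
    + now exists (Some (exist _ y H)).
    + now exists None.
  - intros y y' [z|] E E'; apply sig_eq; congruence.
Qed.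

(** A maximum [x] would leave [seg x] only one point short of the infinite [X], hence of the same
    cardinality. *)
Lemma initial_no_max (X : WO) :
  initial X -> card_le nat X -> forall x : X, exists y, ord x y.
Proof.
  intros HI HN x. apply NNPP. intro N.
  assert (HX : card_le X (option (seg x))).
  { eapply card_le_trans; [|apply card_le_closed_seg].
    assert (H : forall y : X, le y x).
    { intro y. apply not_lt. eauto. }
    exists (fun y => exist _ y (H y)). intros y z E.
    exact (f_equal (@proj1_sig _ _) E). }
  apply (HI x). eapply card_le_trans; [exact HX|].
  apply card_le_option, nat_le_of_option. eapply card_le_trans; eauto.
Qed.

Lemma slexprod_trans (A B : Type) (rA : A -> A -> Prop) (rB : B -> B -> Prop) :
  (forall x y z, rA x y -> rA y z -> rA x z) ->
  (forall x y z, rB x y -> rB y z -> rB x z) ->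
  forall p q s, slexprod A B rA rB p q -> slexprod A B rA rB q s ->
  slexprod A B rA rB p s.
Proof.
  intros TA TB p q s H H'.
  destruct H; inversion H'; subst;
    solve [apply left_slex; eauto | apply right_slex; eauto].
Qed.

(* Goedel's well-ordering of the square; [r] plays the role of the maximum. *)
Definition square_wo (X : WO) (r : X * X -> X) : WO.
Proof.
  refine {| car := X * X;
    ord := fun p q => slexprod X (X * X) ord (slexprod X X ord ord) (r p, p) (r q, q) |}.
  - apply wf_inverse_image with (f := fun p => (r p, p)).
    repeat apply wf_slexprod; apply ord_wf.
  - intros p q t. repeat apply slexprod_trans; apply ord_trans.
  - intros [a b] [c d].
    destruct (ord_total X (r (a, b)) (r (c, d))) as [H|[H|H]].
    + left. now apply left_slex.
    + rewrite H.
      destruct (ord_total X a c) as [O|[<-|O]].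
      * left. now apply right_slex, left_slex.
      * destruct (ord_total X b d) as [O|[<-|O]].
        -- left. now apply right_slex, right_slex.
        -- right; now left.
        -- right; right. now apply right_slex, right_slex.
      * right; right. now apply right_slex, left_slex.
    + right; right. now apply left_slex.
Defined.

(** In the Goedel order the predecessors of [p] lie in the square of the closed segment up to [r p].
    If the whole order did not embed into [X], then [X] would embed into such a square, which is too
    small. *)
Lemma square_step (X : WO) :
  card_le nat X ->
  (forall x : X, card_le nat (seg x) -> card_le (seg x * seg x) (seg x)) ->
  card_le (X * X) X.
Proof.
  intros HN IH.
  (* The first two cases leave [X] uncountable and strictly larger than each of its segments. *)
  destruct (classic (card_le X nat)) as [HX|HX].
  { eapply card_le_trans; [apply card_le_prod; exact HX|].
    eapply card_le_trans; [apply card_le_nat_square|exact HN]. }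
  destruct (classic (exists y : X, card_le X (seg y))) as [[y Hy]|N].
  { eapply card_le_trans; [apply card_le_prod; exact Hy|].
    eapply card_le_trans; [|apply card_le_sig]. apply IH.
    eapply card_le_trans; eauto. }
  destruct (choice_fun (X * X) X (fun p m => le (fst p) m /\ le (snd p) m))
    as [r Hr]; [intros [a b]; apply exists_upper|].
  destruct (card_le_or_seg (square_wo X r) X) as [H|[p H]]; [exact H|exfalso].
  set (B := option (seg (r p))).
  assert (HB : card_le X (B * B)).
  { eapply card_le_trans; [exact H|].
    apply card_le_trans with (B := ({y | le y (r p)} * {y | le y (r p)})%type);
      [|apply card_le_prod; apply card_le_closed_seg].
    assert (Hle : forall q, @ord (square_wo X r) q p -> le (r q) (r p)).
    { intros q O. simpl in O. inversion O; [now left|now right]. }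
    apply card_le_rel with (R := fun q z =>
      proj1_sig q = (proj1_sig (fst z), proj1_sig (snd z))).
    - intros [[a b] O]. destruct (Hr (a, b)) as [Ha Hb].
      specialize (Hle _ O).
      exists (exist _ a (le_trans _ _ _ _ Ha Hle), exist _ b (le_trans _ _ _ _ Hb Hle)).
      reflexivity.
    - intros q q' z E E'. apply sig_eq. simpl in *. congruence. }
  destruct (card_le_nat_or (seg_wo X (r p))) as [Hc|Hc].
  - apply HX. eapply card_le_trans; [exact HB|].
    eapply card_le_trans; [|apply card_le_nat_square].
    apply card_le_prod;
      (eapply card_le_trans; [|apply card_le_option, card_le_refl]);
      now apply card_le_option_mono.
  - apply N. exists (r p). eapply card_le_trans; [exact HB|].
    eapply card_le_trans; [|apply IH, Hc].
    apply card_le_prod; now apply card_le_option.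
Qed.

Lemma card_le_seg_seg (X : WO) (x : X) (y : seg_wo X x) :
  card_le (seg y) (seg (proj1_sig y)) /\ card_le (seg (proj1_sig y)) (seg y).
Proof.
  split;
    [ apply card_le_rel with (R := fun (a : seg y) (b : seg (proj1_sig y)) =>
        proj1_sig (proj1_sig a) = proj1_sig b)
    | apply card_le_rel with (R := fun (b : seg (proj1_sig y)) (a : seg y) =>
        proj1_sig (proj1_sig a) = proj1_sig b) ].
  - intros [a Ha]. now exists (exist _ (proj1_sig a) Ha).
  - intros a a' b E E'. apply sig_eq, sig_eq. congruence.
  - intros [b Hb].
    now exists (exist (fun z : seg_wo X x => ord z y)
      (exist _ b (ord_trans _ _ _ _ Hb (proj2_sig y))) Hb).
  - intros b b' a E E'. apply sig_eq. congruence.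
Qed.

(** Induction on [x]: the segment is itself a well-order, and its segments have the size of earlier
    segments of [X]. *)
Lemma card_le_square_seg (X : WO) (x : X) :
  card_le nat (seg x) -> card_le (seg x * seg x) (seg x).
Proof.
  induction (ord_wf X x) as [x _ IH]. intro HN.
  apply (square_step (seg_wo X x) HN). intros y Hy.
  destruct (card_le_seg_seg X x y) as [H1 H2].
  eapply card_le_trans; [apply card_le_prod; exact H1|].
  eapply card_le_trans; [|exact H2].
  apply IH; [exact (proj2_sig y)|]. eapply card_le_trans; eauto.
Qed.

Lemma card_le_square (X : WO) : card_le nat X -> card_le (X * X) X.
Proof.
  intro HN. apply square_step; [exact HN|]. intros x. apply card_le_square_seg.
Qed.

(** Both factors fit into one infinite segment [seg z], which is as large as its square. *)
Lemma initial_not_le_prod (X : WO) (A : Type) (x y : X) :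
  initial X -> card_le nat A -> card_le A (seg x) ->
  ~ card_le X (A * seg y).
Proof.
  intros HI HN HA H. destruct (exists_upper X x y) as [z [Hx Hy]].
  assert (HAz : card_le A (seg z)).
  { eapply card_le_trans; [exact HA|now apply card_le_seg]. }
  apply (HI z). eapply card_le_trans; [exact H|].
  eapply card_le_trans; [apply card_le_prod|].
  - exact HAz.
  - apply card_le_seg, Hy.
  - apply card_le_square_seg. eapply card_le_trans; eauto.
Qed.

(* [f] is the transitive collapse of [B]; if some initial part of [B] did not
   have bounded image, the collapse of that part would be onto [M]. *)
Lemma otp_lt_of_card (L M : WO) (m0 : M) (B : L -> Prop) :
  ~ card_le M {x | B x} -> otp_lt B M.
Proof.
  intro HB.
  (* The collapse: [m] is the least strict upper bound of the values already given to members of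
     [B]. *)
  set (R := fun x (g : L -> M) m =>
    (forall z, ord z x -> B z -> ord (g z) m) /\
    forall y, ord y m -> exists z, ord z x /\ B z /\ le y (g z)).
  destruct (wf_choice L M m0 R) as [f Hf].
  { intros x g g' E m [H1 H2]. split.
    - intros z Hz Bz. rewrite <- E by assumption. auto.
    - intros y Hy. destruct (H2 y Hy) as [z [Hz [Bz H]]].
      exists z. rewrite <- E by assumption. auto. }
  assert (Hb : forall D : L -> Prop, (forall x, D x -> B x /\ R x f (f x)) ->
    (forall x z, D x -> B z -> ord z x -> D z) ->
    exists m, forall z, D z -> ord (f z) m).
  { intros D HD Hinit. apply NNPP. intro N.
    assert (Honto : forall y, exists z, D z /\ f z = y).
    { intro y. assert (H : exists z, D z /\ le y (f z)).
      { apply NNPP. intro N'. apply N. exists y. intros z Hz.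
        apply not_le. intro H. eauto. }
      destruct (exists_least L _ H) as [z [[Dz Hz] Hmin]].
      exists z. split; [exact Dz|].
      destruct Hz as [Hz|Hz]; [|now symmetry].
      destruct (HD z Dz) as [_ [_ HR]].
      destruct (HR y Hz) as [w [Hw [Bw Hyw]]].
      destruct (lt_not_le _ _ _ Hw). apply Hmin. eauto. }
    apply HB. apply card_le_rel with (R := fun y z => f (proj1_sig z) = y).
    - intro y. destruct (Honto y) as [z [Dz E]].
      now exists (exist _ z (proj1 (HD z Dz))).
    - intros y y' z E E'. congruence. }
  assert (Hall : forall x, R x f (f x)).
  { intro x. induction (ord_wf L x) as [x _ IH]. apply Hf.
    destruct (Hb (fun z => B z /\ ord z x)) as [m Hm].
    - intros z [Bz Hz]. auto.
    - intros y z [By Hy] Bz Hz. split; [exact Bz|eapply ord_trans; eauto].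
    - assert (H : exists m, forall z, B z /\ ord z x -> ord (f z) m) by eauto.
      destruct (exists_least M _ H) as [m' [Hm' Hmin]].
      exists m'. split; [auto|]. intros y Hy. apply NNPP. intro N.
      apply (lt_not_le _ _ _ Hy). apply Hmin. intros z [Bz Hz].
      apply not_le. intro Hle. eauto. }
  destruct (Hb B) as [m Hm]; [auto|auto|].
  exists m, f. split; [|exact Hm].
  intros x y Bx By Hxy. destruct (Hall y) as [H _]. auto.
Qed.

(** * Regular cardinals and cofinality *)

Definition regular (K : WO) : Prop :=
  forall (I : Type) (f : I -> K), ~ card_le K I -> exists b, forall i, ord (f i) b.

(** The cofinal map carries an unbounded family in [K] to an unbounded subset of [M], which has at
    least [K] elements. *)
Lemma cof_regular (M K : WO) : cf_top_is M K -> regular K.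
Proof.
  intros [_ [[phi [Hphi Hub]] Hmin]] I f HI. apply NNPP. intro N. apply HI.
  eapply card_le_trans; [apply (Hmin (fun x => exists i, phi (f i) = x))|].
  - intro y. destruct (Hub y) as [x [[k <-] Hk]].
    apply NNPP. intro N'. apply N. exists k. intro i. apply not_le. intro H.
    apply N'. exists (phi (f i)). split; [eauto|].
    eapply le_trans; [exact Hk|]. apply incr_weak; auto.
  - apply card_le_rel with (R := fun x i => phi (f i) = proj1_sig x).
    + intros [x Hx]. exact Hx.
    + intros x y i E E'. apply sig_eq. congruence.
Qed.

Lemma seg_bounded (K : WO) (k : K) (f : K -> K) :
  initial K -> regular K -> exists b, forall i, ord i k -> ord (f i) b.
Proof.
  intros HI HR. destruct (HR (seg k) (fun i => f (proj1_sig i)) (HI k)) as [b Hb].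
  exists b. intros i Hi. exact (Hb (exist _ i Hi)).
Qed.

(** Take the supremum of an [omega]-sequence in which each term exceeds [F] at everything up to the
    previous term; it exists in [K] because [K] is regular and uncountable. *)
Lemma exists_closed_limit (K : WO) :
  initial K -> regular K -> ~ card_le K nat ->
  forall (F : K -> K) (x0 : K), exists xi, ord x0 xi /\ is_limit xi /\
    forall eta, ord eta xi -> ord (F eta) xi.
Proof.
  intros HI HR HU F x0.
  assert (HN : card_le nat K) by (destruct (card_le_nat_or K); tauto).
  destruct (choice_fun K K (fun x y => ord x y /\
    forall eta, le eta x -> ord (F eta) y)) as [s Hs].
  { intro x. destruct (initial_no_max K HI HN x) as [x' Hx'].
    destruct (seg_bounded K x' F HI HR) as [b Hb].
    destruct (exists_upper K x' b) as [y [H1 H2]].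
    exists y. split; [eapply lt_le_trans; eauto|].
    intros eta H. eapply lt_le_trans; [|exact H2]. apply Hb.
    eapply le_lt_trans; eauto. }
  pose (t := fix t n := match n with 0 => x0 | S n => s (t n) end).
  assert (Hb : exists b, forall n, ord (t n) b) by now apply HR.
  destruct (exists_least K _ Hb) as [xi [Hxi Hmin]].
  assert (Hbelow : forall eta, ord eta xi -> exists n, le eta (t n)).
  { intros eta H. apply NNPP. intro N. apply (lt_not_le _ _ _ H), Hmin.
    intro n. apply not_le. eauto. }
  exists xi. split; [exact (Hxi 0)|split; [split|]].
  - exists x0. exact (Hxi 0).
  - intros eta H. destruct (Hbelow eta H) as [n Hn]. exists (t (S n)).
    split; [|apply Hxi]. eapply le_lt_trans; [exact Hn|]. apply Hs.
  - intros eta H. destruct (Hbelow eta H) as [n Hn].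
    eapply ord_trans; [|apply (Hxi (S n))]. now apply Hs.
Qed.

(** [g] may be constant on long stretches, so it is thinned recursively to a strictly increasing
    sequence. Regularity keeps the recursion going and excludes smaller cofinal sets. *)
Lemma cf_of_monotone (K L : WO) (d : L) (g : K -> L) :
  initial K -> regular K -> card_le nat K -> is_limit d ->
  (forall i j, le i j -> le (g i) (g j)) -> (forall i, ord (g i) d) ->
  (forall y, ord y d -> exists i, le y (g i)) -> cf_is d K.
Proof.
  intros HI HR HN [_ Hlim] Hmono Hbelow Hcof.
  split; [exact HI|split].
  - destruct HN as [nk _].
    destruct (wf_choice K K (nk 0) (fun k e j => le k j /\
      forall i, ord i k -> ord (g (e i)) (g j))) as [e He].
    { intros k e e' E j [H1 H2]. split; [exact H1|].
      intros i Hi. rewrite <- E by assumption. auto. }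
    assert (He' : forall k, le k (e k) /\ forall i, ord i k -> ord (g (e i)) (g (e k))).
    { intro k. apply He.
      (* [g b] dominates all values chosen before stage [k], and the limit [d] leaves room above
         it. *)
      destruct (seg_bounded K k e HI HR) as [b Hb].
      destruct (Hlim (g b) (Hbelow b)) as [z [Hz Hzd]].
      destruct (Hcof z Hzd) as [i0 Hi0].
      destruct (exists_upper K i0 k) as [j [Hj Hkj]].
      exists j. split; [exact Hkj|]. intros i Hi.
      apply le_lt_trans with (y := g b); [apply Hmono; left; auto|].
      eapply lt_le_trans; [exact Hz|]. eapply le_trans; eauto. }
    exists (fun k => g (e k)). split; [|split; [auto|]].
    + intros i j _ _ Hij. now apply He'.
    + intros y Hy. destruct (Hcof y Hy) as [i Hi]. exists (g (e i)).
      split; [eauto|split; [auto|]]. eapply le_trans; [exact Hi|].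
      apply Hmono. apply He'.
  - intros B HB HBu. apply NNPP. intro N.
    destruct (choice_fun {x | B x} K (fun x i => le (proj1_sig x) (g i))) as [f Hf].
    { intros [x Hx]. simpl. auto. }
    destruct (HR _ f N) as [b Hb].
    destruct (Hlim (g b) (Hbelow b)) as [z [Hz Hzd]].
    destruct (HBu z Hzd) as [w [Bw [_ Hw]]].
    apply (lt_not_le _ _ _ Hz). eapply le_trans; [exact Hw|].
    eapply le_trans; [exact (Hf (exist _ w Bw))|].
    apply Hmono. left. apply Hb.
Qed.

(* Otherwise the bounds of [A] on the sets [b i] form a weakly increasing cofinal
   [K]-sequence. *)
Lemma unbounded_piece (K L : WO) (d : L) (A : L -> Prop) (b : K -> L -> Prop) :
  initial K -> regular K -> card_le nat K -> is_limit d -> ~ cf_is d K ->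
  (forall i j x, le i j -> b i x -> b j x) ->
  (forall x, ord x d -> exists i, b i x) ->
  unbounded_below d A -> exists i, unbounded_below d (fun x => A x /\ b i x).
Proof.
  intros HI HR HN Hlim Hcf Hmono Hcov HA. apply NNPP. intro N. apply Hcf.
  set (Q := fun i y => ord y d /\ forall z, A z -> b i z -> ord z d -> ord z y).
  destruct (choice_fun K L (fun i y => Q i y /\ forall y', Q i y' -> le y y'))
    as [g Hg].
  { intro i. apply exists_least. apply NNPP. intro N'. apply N. exists i.
    intros y Hy. apply NNPP. intro N''. apply N'. exists y. split; [exact Hy|].
    intros z Az Bz Hz. apply not_le. intro H. apply N''. exists z. auto. }
  apply cf_of_monotone with (g := g); try assumption.
  - intros i j Hij. apply Hg. destruct (Hg j) as [[H1 H2] _].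
    split; [exact H1|]. intros z Az Bz Hz. eauto.
  - intro i. apply Hg.
  - intros y Hy. destruct (HA y Hy) as [z [Az [Hz Hyz]]].
    destruct (Hcov z Hz) as [i Bz]. exists i. left.
    eapply le_lt_trans; [exact Hyz|]. now apply Hg.
Qed.

(** * Ladders, and the club on which [h] increases *)

(** The last clause is continuity: at a limit [xi], [c xi] is the supremum of the earlier values. *)
Definition ladder {K L : WO} (d : L) (c : K -> L) : Prop :=
  (forall xi eta, ord xi eta -> ord (c xi) (c eta)) /\
  (forall xi, ord (c xi) d) /\
  (forall y, ord y d -> exists xi, ord y (c xi)) /\
  (forall xi, is_limit xi -> forall y, ord y (c xi) ->
     exists eta, ord eta xi /\ ord y (c eta)).

(** The cofinal map [f] need not be continuous; taking at [xi] the least strict upper bound of its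
    earlier values makes it so. *)
Lemma cf_ladder (K L : WO) (d : L) :
  card_le nat K -> cf_is d K -> exists c : K -> L, ladder d c.
Proof.
  intros HN [HI [[f [Hf [Hfd Hfu]]] _]].
  destruct (choice_fun K L (fun xi x => (forall i, ord i xi -> ord (f i) x) /\
    forall y, (forall i, ord i xi -> ord (f i) y) -> le x y)) as [c Hc].
  { intro xi. apply exists_least. exists (f xi). intros i. now apply Hf. }
  assert (Hcf : forall xi, le (c xi) (f xi)).
  { intro xi. apply Hc. intros i. now apply Hf. }
  exists c. split; [|split; [|split]].
  - intros xi eta H. eapply le_lt_trans; [apply Hcf|]. now apply Hc.
  - intro xi. eapply le_lt_trans; [apply Hcf|apply Hfd].
  - intros y Hy. destruct (Hfu y Hy) as [z [[i <-] [_ Hyi]]].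
    destruct (initial_no_max K HI HN i) as [i' Hi'].
    exists i'. eapply le_lt_trans; [exact Hyi|]. now apply Hc.
  - intros xi [_ Hxi] y Hy.
    assert (H : exists i, ord i xi /\ le y (f i)).
    { apply NNPP. intro N. apply (lt_not_le _ _ _ Hy), Hc.
      intros i Hi. apply not_le. eauto. }
    destruct H as [i [Hi Hyi]]. destruct (Hxi i Hi) as [i' [Hi' Hi'xi]].
    exists i'. split; [exact Hi'xi|]. eapply le_lt_trans; [exact Hyi|].
    now apply Hc.
Qed.

Lemma ladder_limit (K L : WO) (d : L) (c : K -> L) (xi : K) :
  ladder d c -> is_limit xi -> is_limit (c xi).
Proof.
  intros [Hinc [_ [_ Hcont]]] Hxi. split.
  - destruct Hxi as [[eta H] _]. exists (c eta). auto.
  - intros y Hy. destruct (Hcont xi Hxi y Hy) as [eta [H1 H2]]. eauto.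
Qed.

(** [c xi] is the limit of the values before it, and these are fewer than [K]. This makes
    [unbounded_piece] applicable at [c xi]. *)
Lemma ladder_cf (K L : WO) (d : L) (c : K -> L) (xi : K) :
  initial K -> ladder d c -> is_limit xi -> ~ cf_is (c xi) K.
Proof.
  intros HI [Hinc [_ [_ Hcont]]] Hxi [_ [_ Hmin]].
  apply (HI xi). eapply card_le_trans.
  - apply (Hmin (fun x => exists eta, ord eta xi /\ x = c eta)).
    + intros x [eta [H ->]]. auto.
    + intros y Hy. destruct (Hcont xi Hxi y Hy) as [eta [H1 H2]].
      exists (c eta). split; [eauto|split; [auto|now left]].
  - apply card_le_rel with (R := fun x eta => proj1_sig x = c (proj1_sig eta)).
    + intros [x [eta [H ->]]]. now exists (exist _ eta H).
    + intros x x' eta E E'. apply sig_eq. congruence.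
Qed.

(* [h] tends to [K] along the good points [c xi] of the ladder; at the points
   closed under a modulus [F] of this convergence, [h (c xi)] lies in
   [[xi, xi')], with [xi'] the next such point. *)
Lemma club_incr (K L : WO) (d : L) (c : K -> L) (A : L -> Prop) (h : L -> K) :
  initial K -> regular K -> ~ card_le K nat -> ladder d c -> unbounded_below d A ->
  (forall j, exists y, ord y d /\ forall xi, is_limit xi ->
     unbounded_below (c xi) A -> le (h (c xi)) j -> ord (c xi) y) ->
  exists C, club_below d C /\ incr_on C h.
Proof.
  intros HI HR HU HL HA Hh.
  assert (HN : card_le nat K) by (destruct (card_le_nat_or K); tauto).
  pose proof HL as [Hinc [Hbelow [Hcof Hcont]]].
  pose proof (incr_reflect _ _ c Hinc) as Hrefl.
  pose proof (incr_weak _ _ c Hinc) as Hweak.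
  (* Call a limit [xi] good if [A] is unbounded in [c xi]. [F eta] exceeds [h (c eta)] and every
     good [xi] with [h (c xi)] at most [eta]; the point of [A] between [c eta] and [c (F eta)] makes
     every limit closed under [F] good. *)
  destruct (choice_fun K K (fun eta zeta => ord (h (c eta)) zeta /\
    (forall xi, is_limit xi -> unbounded_below (c xi) A -> le (h (c xi)) eta ->
       ord xi zeta) /\
    exists w, A w /\ le (c eta) w /\ ord w (c zeta))) as [F HF].
  { intro eta.
    destruct (initial_no_max K HI HN (h (c eta))) as [z1 H1].
    destruct (Hh eta) as [y [Hy H2]]. destruct (Hcof y Hy) as [z2 Hz2].
    destruct (HA (c eta) (Hbelow eta)) as [w [Aw [Hw H3]]].
    destruct (Hcof w Hw) as [z3 Hz3].
    destruct (exists_upper K z1 z2) as [z4 [H14 H24]].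
    destruct (exists_upper K z4 z3) as [z [H4 H34]].
    exists z. split; [|split].
    - eapply lt_le_trans; [exact H1|]. eapply le_trans; eauto.
    - intros xi Hxi Hu Hle. apply lt_le_trans with (y := z2);
        [|eapply le_trans; [exact H24|exact H4]].
      apply Hrefl. eapply ord_trans; [|exact Hz2]. auto.
    - exists w. split; [exact Aw|split; [exact H3|]].
      eapply lt_le_trans; [exact Hz3|]. auto. }
  set (D := fun xi => is_limit xi /\ forall eta, ord eta xi -> ord (F eta) xi).
  assert (HDA : forall xi, D xi -> unbounded_below (c xi) A).
  { intros xi [Hxi HFxi] y Hy. destruct (Hcont xi Hxi y Hy) as [eta [H1 H2]].
    destruct (HF eta) as [_ [_ [w [Aw [Hw1 Hw2]]]]].
    exists w. split; [exact Aw|split].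
    - eapply ord_trans; [exact Hw2|]. auto.
    - left. eapply lt_le_trans; eauto. }
  exists (fun x => exists xi, D xi /\ x = c xi). split; [split; [|split]|].
  - intros x [xi [_ ->]]. apply Hbelow.
  - intros y Hy. destruct (Hcof y Hy) as [x0 Hx0].
    destruct (exists_closed_limit K HI HR HU F x0) as [xi [H1 H2]].
    exists (c xi). split; [now exists xi|split; [apply Hbelow|]].
    left. eapply ord_trans; eauto.
  (* Closure: the least [xi] with [c xi] at least [g] is a limit of [D], hence in [D], and
     continuity gives [c xi = g]. *)
  - intros g Hg [[y0 Hy0] Hglim] Hgu.
    assert (Hsup : forall y, ord y g -> exists xi, D xi /\ ord y (c xi) /\ ord (c xi) g).
    { intros y Hy. destruct (Hglim y Hy) as [y' [H1 H2]].
      destruct (Hgu y' H2) as [x [[xi [Dxi ->]] [Hx Hle]]].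
      exists xi. split; [exact Dxi|split; [|exact Hx]]. eapply lt_le_trans; eauto. }
    assert (Hex : exists xi, le g (c xi)).
    { destruct (Hcof g Hg) as [xi H]. exists xi. now left. }
    destruct (exists_least K _ Hex) as [xi [Hxi Hmin]].
    assert (Hlt : forall eta, ord eta xi -> ord (c eta) g).
    { intros eta H. apply not_le. intro H'. exact (lt_not_le _ _ _ H (Hmin _ H')). }
    assert (Hnext : forall eta, ord eta xi ->
      exists zeta, D zeta /\ ord eta zeta /\ ord zeta xi).
    { intros eta H. destruct (Hsup _ (Hlt eta H)) as [z [Dz [H1 H2]]].
      exists z. split; [exact Dz|split; [auto|]].
      apply Hrefl. eapply lt_le_trans; eauto. }
    assert (Dxi : D xi).
    { split; [split|].
      - destruct (Hsup y0 Hy0) as [z [_ [_ H]]]. exists z.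
        apply Hrefl. eapply lt_le_trans; eauto.
      - intros eta H. destruct (Hnext eta H) as [z [_ H']]. eauto.
      - intros eta H. destruct (Hnext eta H) as [z [[_ Dz] [H1 H2]]].
        eapply ord_trans; eauto. }
    exists xi. split; [exact Dxi|]. apply le_antisym; [exact Hxi|].
    apply not_lt. intro H. destruct Dxi as [Hxlim _].
    destruct (Hcont xi Hxlim g H) as [eta [H1 H2]].
    exact (ord_irrefl _ _ (ord_trans _ _ _ _ H2 (Hlt eta H1))).
  - intros x x' [xi [Dxi ->]] [xi' [Dxi' ->]] Hxx.
    apply Hrefl in Hxx.
    apply ord_trans with (y := F xi); [exact (proj1 (HF xi))|].
    apply lt_le_trans with (y := xi'); [now apply Dxi'|].
    (* If [h (c xi')] were below [xi'], then [F] at that value would exceed [xi'] since [xi'] is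
       good, yet stay below [xi'] by closure. *)
    apply not_lt. intro H.
    apply (ord_irrefl _ xi').
    eapply ord_trans; [|apply Dxi', H].
    apply (proj1 (proj2 (HF _))); [apply Dxi'|now apply HDA|apply le_refl].
Qed.

(** * Successor cardinals and their clubs *)

Lemma big_unbounded (M L : WO) (A : L -> Prop) :
  card_le nat M -> is_succ_card M L -> big A -> forall x, exists y, A y /\ ord x y.
Proof.
  intros HN [_ [[_ HML] Hseg]] HA x. apply NNPP. intro N. apply HML.
  eapply card_le_trans; [exact HA|].
  apply card_le_trans with (B := {y | le y x}).
  { apply card_le_sub. intros y Hy. apply not_lt. eauto. }
  eapply card_le_trans; [apply card_le_closed_seg|].
  eapply card_le_trans; [|apply card_le_option, HN].
  apply card_le_option_mono, Hseg.
Qed.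

Lemma succ_card_enum (M L : WO) :
  card_le nat M -> is_succ_card M L -> exists e : L -> L -> M,
    forall d x y, ord x d -> ord y d -> e d x = e d y -> x = y.
Proof.
  intros [nm _] [_ [_ Hseg]].
  destruct (choice_fun L (L -> M) (fun d f => forall x y, ord x d -> ord y d ->
    f x = f y -> x = y)) as [e He]; [|now exists e].
  intro d. destruct (Hseg d) as [f Hf].
  destruct (choice_fun L M (fun x m => forall H : ord x d, m = f (exist _ x H)))
    as [f' Hf'].
  - intro x. destruct (classic (ord x d)) as [H|N].
    + exists (f (exist _ x H)). intro H'. do 2 f_equal. apply proof_irrelevance.
    (* Points outside the segment get the filler [nm 0]. *)
    + exists (nm 0). intro H. now destruct N.
  - exists f'. intros x y Hx Hy E. rewrite (Hf' x Hx), (Hf' y Hy) in E.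
    apply Hf in E. exact (f_equal (@proj1_sig _ _) E).
Qed.

(** Otherwise [L] is a countable union of segments of size at most [M], hence embeds into [M]. *)
Lemma succ_card_nat_bounded (M L : WO) (s : nat -> L) :
  card_le nat M -> is_succ_card M L -> exists b, forall n, ord (s n) b.
Proof.
  intros HN HL. apply NNPP. intro N.
  destruct (succ_card_enum M L HN HL) as [e He].
  pose proof HL as [HI [[HMl HML] _]].
  assert (HNL : card_le nat L) by (eapply card_le_trans; eauto).
  apply HML. apply card_le_trans with (B := (nat * M)%type).
  - apply card_le_rel with (R := fun x p => ord x (s (fst p)) /\
      snd p = e (s (fst p)) x).
    + intro x. destruct (initial_no_max L HI HNL x) as [x' Hx'].
      assert (H : exists n, le x' (s n)).
      { apply NNPP. intro N'. apply N. exists x'. intro n. apply not_le. eauto. }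
      destruct H as [n Hn]. exists (n, e (s n) x). split; [|reflexivity].
      eapply lt_le_trans; eauto.
    + intros x y p [Hx E] [Hy E']. apply (He (s (fst p))); congruence || auto.
  - eapply card_le_trans; [|apply card_le_square, HN].
    apply card_le_prod; [exact HN|apply card_le_refl].
Qed.

(** Besides limit points of [A], the set asks that [M] embed into the segment of [a], since
    elsewhere the guessing families will be empty. *)
Lemma club_limits (M L : WO) (A : L -> Prop) :
  card_le nat M -> is_succ_card M L -> big A ->
  club (fun a : L => card_le M (seg a) /\ unbounded_below a A).
Proof.
  intros HN HL HA. pose proof (big_unbounded M L A HN HL HA) as Hu. split.
  - intro y.
    assert (Ha : exists a : L, card_le M (seg a)).
    { destruct (card_le_or_seg L M) as [H|H]; [|exact H].
      destruct HL as [_ [[_ HML] _]]. now destruct HML. }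
    destruct Ha as [a Ha]. destruct (exists_upper L y a) as [x0 [Hy Hax]].
    (* The supremum of an [omega]-sequence in [A] above [x0] is the required point. *)
    destruct (choice_fun L L (fun x z => A z /\ ord x z) Hu) as [nx Hnx].
    pose (t := fix t n := match n with 0 => x0 | S n => nx (t n) end).
    destruct (exists_least L _ (succ_card_nat_bounded M L t HN HL)) as [z [Hz Hmin]].
    exists z. assert (Hyz : ord x0 z) by exact (Hz 0). split; [split|].
    + eapply card_le_trans; [exact Ha|]. apply card_le_seg.
      left. eapply le_lt_trans; eauto.
    + intros w Hw. assert (H : exists n, le w (t n)).
      { apply NNPP. intro N. apply (lt_not_le _ _ _ Hw), Hmin.
        intro n. apply not_le. eauto. }
      destruct H as [n Hn]. exists (t (S n)). split; [apply Hnx|split; [apply Hz|]].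
      left. eapply le_lt_trans; [exact Hn|]. apply Hnx.
    + left. eapply le_lt_trans; eauto.
  - intros d [[y0 Hy0] Hd] Hub. split.
    + destruct (Hub y0 Hy0) as [z [[Hz _] [Hzd _]]].
      eapply card_le_trans; [exact Hz|]. apply card_le_seg. now left.
    + intros y Hy. destruct (Hd y Hy) as [y' [H1 H2]].
      destruct (Hub y' H2) as [z [[_ Hz] [Hzd Hle]]].
      destruct (Hz y (lt_le_trans _ _ _ _ H1 Hle)) as [w [Aw [Hw Hyw]]].
      exists w. split; [exact Aw|split; [eapply ord_trans; eauto|exact Hyw]].
Qed.

(** * The guessing families *)

(** One sequence serves all cofinalities. The size of the points of [C] is recorded for the later
    passage to subsets. *)
Lemma minus_families (M K L : WO) (HM : initial M) (Hcf : cf_top_is M K)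
  (HKM : card_lt K M) (HK : uncountable K) (HL : is_succ_card M L) :
  exists P, family_minus M L (fun _ => True) P /\
    forall A, big A -> exists C, club C /\
      (forall a : L, C a -> card_le M (seg a)) /\
      (forall a, C a -> is_limit a -> ~ cf_is a K -> G_minus P A a) /\
      in_I L K (fun a => C a /\ is_limit a /\ ~ G_minus P A a).
Proof.
  pose proof Hcf as [HI [[g [Hg Hgu]] _]].
  pose proof (cof_regular M K Hcf) as HR.
  assert (HNK : card_le nat K).
  { destruct (card_le_nat_or K) as [H|H]; [now destruct HK|exact H]. }
  assert (HN : card_le nat M) by (eapply card_le_trans; [exact HNK|apply HKM]).
  pose proof HNK as [nk _]. pose (k0 := nk 0).
  destruct (succ_card_enum M L HN HL) as [e He].
  set (b := fun d i x => ord x d /\ ord (e d x) (g i)).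
  assert (Hbmono : forall d i j x, le i j -> b d i x -> b d j x).
  { intros d i j x Hij [H1 H2]. split; [exact H1|].
    eapply lt_le_trans; [exact H2|]. apply incr_weak; auto. }
  assert (Hbcov : forall d x, ord x d -> exists i, b d i x).
  { intros d x Hx. destruct (Hgu (e d x)) as [y [[i <-] Hi]].
    destruct (initial_no_max K HI HNK i) as [j Hj].
    exists j. split; [exact Hx|]. eapply le_lt_trans; eauto. }
  (* At cofinalities other than [K], [c d] is constantly [d], so that [a d i] reduces to [b d i]. *)
  destruct (choice_fun L (K -> L) (fun d c => (cf_is d K -> ladder d c) /\
    (~ cf_is d K -> forall xi, c xi = d))) as [c Hc].
  { intro d. destruct (classic (cf_is d K)) as [H|H].
    - destruct (cf_ladder K L d HNK H) as [c Hc]. exists c. tauto.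
    - exists (fun _ => d). tauto. }
  assert (Hcle : forall d xi, le (c d xi) d).
  { intros d xi. destruct (Hc d) as [H1 H2].
    destruct (classic (cf_is d K)) as [H|H].
    - left. now apply (H1 H).
    - right. auto. }
  set (a := fun d i x => exists xi, b (c d xi) i x).
  assert (Had : forall d i x, a d i x -> ord x d).
  { intros d i x [xi [H _]]. eapply lt_le_trans; eauto. }
  (* The family is empty when [d] has fewer than [M] predecessors, as [K] many sets could be too
     many there. *)
  set (P := fun d B => card_le M (seg d) /\ unbounded_below d B /\
    exists i, B = a d i).
  exists P. split.
  { intros d _ _. split.
    - destruct (classic (card_le M (seg d))) as [HMd|HMd].
      + eapply card_le_trans; [|exact HMd].
        eapply card_le_trans; [|apply HKM].
        apply card_le_rel with (R := fun B i => proj1_sig B = a d i).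
        * intros [B HB]. apply HB.
        * intros B B' i E E'. apply sig_eq. congruence.
      + apply card_le_rel with (R := fun _ _ => True).
        * intros [B HB]. now destruct HMd, HB.
        * intros [B HB]. now destruct HMd, HB.
    - intros B [_ [Hu [i ->]]]. split; [apply Had|split; [exact Hu|]].
      apply otp_lt_of_card; [exact (g k0)|]. intro H.
      (* [K] embeds into a proper segment of [M], so a set [a d i] of size [M] would embed [M] into
         a product of two smaller sets. *)
      destruct (card_le_or_seg M K) as [HMK|[m Hm]]; [now apply HKM|].
      apply (initial_not_le_prod M K m (g i) HM HNK Hm).
      eapply card_le_trans; [exact H|].
      apply card_le_rel with (R := fun x p => ord (proj1_sig x) (c d (fst p)) /\
        e (c d (fst p)) (proj1_sig x) = proj1_sig (snd p)).
      + intros [x [xi [H1 H2]]]. now exists (xi, exist (fun y => ord y (g i)) _ H2).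
      + intros x y p [Hx E] [Hy E']. apply sig_eq.
        apply (He (c d (fst p))); congruence || auto. }
  intros A HA. exists (fun a : L => card_le M (seg a) /\ unbounded_below a A).
  split; [now apply (club_limits M)|split; [tauto|split]].
  - intros d [HMd HAd] Hlim Hncf.
    destruct (unbounded_piece K L d A (b d) HI HR HNK Hlim Hncf
      (Hbmono d) (Hbcov d) HAd) as [i Hi].
    assert (E : forall x, a d i x <-> b d i x).
    { intro x. unfold a. destruct (Hc d) as [_ H]. split.
      - intros [xi Hx]. now rewrite (H Hncf) in Hx.
      - intro Hx. exists k0. now rewrite (H Hncf). }
    exists (a d i). split; [split; [exact HMd|split; [|now exists i]]|];
      intros y Hy; destruct (Hi y Hy) as [z [[Az Bz] Hz]]; exists z;
      apply E in Bz; tauto.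
  - destruct (choice_fun L K (fun x i =>
      (exists i', unbounded_below x (fun z => A z /\ b x i' z)) ->
      unbounded_below x (fun z => A z /\ b x i z))) as [h Hh].
    { intro x. destruct (classic (exists i', unbounded_below x
        (fun z => A z /\ b x i' z))) as [[i Hi]|N]; [now exists i|].
      (* Default where no index works; by [unbounded_piece] this never happens at a limit of [A] of
         cofinality other than [K]. *)
      exists k0. tauto. }
    exists h. intros d [[HMd HAd] [Hlim HG]] Hcfd.
    destruct (Hc d) as [HL' _]. specialize (HL' Hcfd).
    apply club_incr with (d := d) (c := c d) (A := A); try assumption.
    intro j. apply NNPP. intro N. apply HG.
    assert (Hj : unbounded_below d (fun x => a d j x /\ A x)).
    { intros y Hy. destruct Hlim as [_ Hlim].
      destruct (Hlim y Hy) as [y' [H1 H2]]. apply NNPP. intro N'.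
      (* If [A] misses [a d j] from [y] on, then [y'] bounds the relevant [c xi]: one at or above
         [y'] would have points of [A] at or above [y] in its piece, which is part of [a d j]. *)
      apply N. exists y'. split; [exact H2|].
      intros xi Hxi HAxi Hle. apply not_le. intro Hy'. apply N'.
      destruct (Hh (c d xi)) with (y := y) as [w [[Aw Bw] [Hw Hyw]]].
      - apply (unbounded_piece K L); try assumption.
        + eapply ladder_limit; eauto.
        + eapply ladder_cf; eauto.
        + apply Hbmono.
        + apply Hbcov.
      - eapply lt_le_trans; eauto.
      - exists w. split; [split; [exists xi; eauto|exact Aw]|].
        split; [|exact Hyw]. eapply lt_le_trans; [exact Hw|apply Hcle]. }
    exists (a d j). split; [split; [exact HMd|split; [|now exists j]]|exact Hj].
    intros y Hy. destruct (Hj y Hy) as [z [[Az Bz] Hz]]. eauto.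
Qed.

(** All unbounded subsets of the old sets are taken. Order type below [M] lets each subset be coded
    by a subset of a segment of [M], hence by an element of [M]; with at most [M] old sets, pairs
    from [M] suffice as codes. *)
Lemma plain_families (M L : WO) (S : L -> Prop) (P : L -> (L -> Prop) -> Prop) :
  card_le nat M -> is_succ_card M L -> strong_limit M ->
  family_minus M L S P ->
  exists P', family_plain L S P' /\
    forall A a, card_le M (seg a) -> G_minus P A a -> G_plain P' A a.
Proof.
  intros HN HL Hsl HP.
  exists (fun a B' => card_le M (seg a) /\ unbounded_below a B' /\
    exists B, P a B /\ forall x, B' x -> B x).
  split.
  - intros a Sa Hlim. destruct (HP a Sa Hlim) as [Hcard HB]. split.
    2:{ intros B' [_ [Hu [B [PB Hsub]]]]. split; [|exact Hu].
        intros x Hx. apply (HB B PB). auto. }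
    destruct (classic (card_le M (seg a))) as [HMa|HMa].
    2:{ apply card_le_rel with (R := fun _ _ => True);
        intros [B HB']; now destruct HMa, HB'. }
    eapply card_le_trans; [|exact HMa].
    eapply card_le_trans; [|apply card_le_square, HN].
    (* Injectivity on subsets of [seg m] is stated as an inclusion; symmetry in [X] and [Y] turns it
       into equality. *)
    destruct (choice_fun M ((M -> Prop) -> M) (fun m code => forall X Y,
      (forall y, X y -> ord y m) -> (forall y, Y y -> ord y m) ->
      code X = code Y -> forall y, X y -> Y y)) as [code Hcode].
    { intro m. destruct (Hsl m) as [[f Hf] _].
      exists (fun X => f (fun y : seg m => X (proj1_sig y))).
      intros X Y HX HY E y Xy. apply Hf in E.
      pose proof (f_equal (fun Z => Z (exist _ y (HX y Xy))) E) as E'.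
      simpl in E'. now rewrite <- E'. }
    destruct (card_le_trans _ _ _ Hcard (proj2 (proj2 HL) a)) as [n Hn].
    destruct (choice_fun {B | P a B} (M * (L -> M)) (fun B p =>
      incr_on (proj1_sig B) (snd p) /\
      forall x, proj1_sig B x -> ord (snd p x) (fst p))) as [w Hw].
    { intros [B PB]. destruct (HB B PB) as [_ [_ [m [f Hf]]]]. now exists (m, f). }
    set (im := fun (B : {B | P a B}) (B' : L -> Prop) (y : M) =>
      exists x, B' x /\ snd (w B) x = y).
    (* A subset is recorded by the index of an old set containing it and the code of its image under
       the increasing map of that set into [M]. *)
    apply card_le_rel with (R := fun B' p => exists B : {B | P a B},
      (forall x, proj1_sig B' x -> proj1_sig B x) /\
      p = (n B, code (fst (w B)) (im B (proj1_sig B')))).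
    + intros [B' HB']. simpl. destruct HB' as [_ [_ [B [PB Hsub]]]].
      eexists. exists (exist _ B PB). split; [exact Hsub|reflexivity].
    + intros B1' B2' p [B1 [H1 ->]] [B [H2 E]].
      injection E as E1 E2. apply Hn in E1. subst B1.
      destruct (Hw B) as [Hinc Hlt].
      assert (Hinj : forall x y, proj1_sig B x -> proj1_sig B y ->
        snd (w B) x = snd (w B) y -> x = y).
      { intros x y Bx By E.
        destruct (ord_total L x y) as [O|[O|O]]; [|exact O|];
          apply Hinc in O; try assumption; rewrite E in O;
          now apply ord_irrefl in O. }
      assert (Him : forall X Y : L -> Prop, (forall x, X x -> proj1_sig B x) ->
        (forall x, Y x -> proj1_sig B x) ->
        code (fst (w B)) (im B X) = code (fst (w B)) (im B Y) ->
        forall x, X x -> Y x).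
      { intros X Y HX HY E x Xx.
        assert (Hlt' : forall Z : L -> Prop, (forall x, Z x -> proj1_sig B x) ->
          forall y, im B Z y -> ord y (fst (w B))).
        { intros Z HZ y [z [Zz <-]]. auto. }
        destruct (Hcode _ _ _ (Hlt' X HX) (Hlt' Y HY) E (snd (w B) x))
          as [z [Yz Ez]].
        - exists x. auto.
        - apply Hinj in Ez; [now subst z|auto|auto]. }
      apply sig_eq, pred_ext. intro x. split; apply Him; auto.
  - intros A a HMa [B [PB Hu]]. exists (fun x => B x /\ A x).
    split; [split; [exact HMa|split; [exact Hu|]]|]; [|tauto].
    exists B. split; [exact PB|tauto].
Qed.

Theorem theorem2p8 (M K L : WO)
  (HM : initial M) (Hcf : cf_top_is M K) (HKM : card_lt K M)
  (HK : uncountable K) (HL : is_succ_card M L) :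
  (clubsuit_minus M L (fun d => ~ S_cof K d) /\
   clubsuit_minus_mod M L (S_cof K) (in_I L K)) /\
  (strong_limit M ->
   clubsuit_star L (fun d => ~ S_cof K d) /\
   clubsuit_star_mod L (S_cof K) (in_I L K)).
Proof.
  destruct (minus_families M K L HM Hcf HKM HK HL) as [P [HP HG]].
  split; [split|intro Hsl].
  - exists P. split; [intros a _; now apply HP|].
    intros A HA. destruct (HG A HA) as [C [HC [_ [H _]]]]. exists C. auto.
  - exists P. split; [intros a _; now apply HP|].
    intros A HA. destruct (HG A HA) as [C [HC [_ [_ [h Hh]]]]].
    exists C. split; [exact HC|]. exists h. intros d Hd. apply Hh. tauto.
  - assert (HN : card_le nat M).
    { destruct (card_le_nat_or K) as [H|H]; [now destruct HK|].
      eapply card_le_trans; [exact H|apply HKM]. }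
    destruct (plain_families M L (fun _ => True) P HN HL Hsl HP) as [P' [HP' HG']].
    split; exists P'; (split; [intros a _; now apply HP'|]);
      intros A HA; destruct (HG A HA) as [C [HC [HCM [H [h Hh]]]]];
      exists C; (split; [exact HC|]).
    + auto.
    (* On [C], failure of the plain guess implies failure of the old one, by [HG'], so the same [h]
       witnesses membership in the ideal. *)
    + exists h. intros d [Cd [_ [Hlim N]]]. apply Hh.
      split; [exact Cd|split; [exact Hlim|]]. auto.
Qed.
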